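(* For $n\ge1$, \[\mathrm{WI}_n=\sum_{k=0}^{n-1}\binom{n-1}{k}2^kE_k\,\mathrm{WI}_{n-k-1},\] where $\mathrm{WI}_n$ is defined in the context and the Euler numbers $E_k$ are defined by $\sum_{k\ge0}E_k\frac{x^k}{k!}=\sec x+\tan x$.
   Context: For $n\ge1$, $S_n$ is the set of permutations of $\{0,\dots,n-1\}$ in one-line notation. $S^3_n$ is the set of pairs $\Pi=(\pi^2,\pi^3)$ of elements of $S_n$ (for $n=0$, the single empty permutation); its elements are the columns $\Pi_j=(\pi^2_j,\pi^3_j)^T$ with level $\mathrm{lev}(\Pi_j)=\max\{\pi^2_j,\pi^3_j\}$. $\mathrm{WI}_n$ is the number of $\Pi\in S^3_n$ with $\mathrm{lev}(\Pi_1)\le\dots\le\mathrm{lev}(\Pi_n)$ (so $\mathrm{WI}_0=1$). *)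

(* Defs.v *)
From mathcomp Require Import all_boot all_order all_algebra.
From mathcomp Require Import perm.

Set Implicit Arguments.
Unset Strict Implicit.
Unset Printing Implicit Defensive.

Import GRing.Theory.
Local Open Scope ring_scope.

(* The first component of [P] is pi^2, the second one is pi^3; positions and
   values are both numbered from 0. *)
Definition perm3 (n : nat) : finType := ('S_n * 'S_n)%type.

Definition column (n : nat) (P : perm3 n) (j : 'I_n) : 'I_n * 'I_n :=
  (P.1 j, P.2 j).

Definition lev (n : nat) (c : 'I_n * 'I_n) : nat := maxn c.1 c.2.

(* [enum 'I_n] lists 0, ..., n-1 in increasing order. *)
Definition weakly_increasing (n : nat) (P : perm3 n) : bool :=
  sorted leq [seq lev (column P j) | j <- enum 'I_n].

Definition WI (n : nat) : nat := #|[set P : perm3 n | weakly_increasing P]|.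

(* A formal power series over the rationals is its sequence of coefficients;
   the generating function defining the Euler numbers is read in this ring. *)
Definition fps : Type := nat -> rat.

Definition fps_one : fps := fun n => (n == 0%N)%:R.

Definition fps_add (f g : fps) : fps := fun n => f n + g n.

Definition fps_mul (f g : fps) : fps :=
  fun n => \sum_(i < n.+1) f i * g (n - i)%N.

(* The coefficients 0, ..., n of the inverse of [f], obtained by solving
   f * g = 1 degree by degree; meaningful when [f 0 != 0]. *)
Fixpoint fps_inv_prefix (f : fps) (n : nat) : seq rat :=
  if n is m.+1 then
    let s := fps_inv_prefix f m in
    rcons s (- (f 0%N)^-1 * \sum_(i < m.+1) f i.+1 * s`_(m - i))
  else [:: (f 0%N)^-1].

Definition fps_inv (f : fps) : fps := fun n => (fps_inv_prefix f n)`_n.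

Definition fps_cos : fps :=
  fun n => if odd n then 0 else (-1) ^+ n./2 / n`!%:R.

Definition fps_sin : fps :=
  fun n => if odd n then (-1) ^+ n./2 / n`!%:R else 0.

Definition fps_sec : fps := fps_inv fps_cos.

Definition fps_tan : fps := fps_mul fps_sin fps_sec.

Definition euler (k : nat) : rat := k`!%:R * fps_add fps_sec fps_tan k.

Lemma size_fps_inv_prefix (f : fps) (n : nat) :
  size (fps_inv_prefix f n) = n.+1.
Proof. by elim: n => //= n IHn; rewrite size_rcons IHn. Qed.

Lemma nth_fps_inv_prefix (f : fps) (n i : nat) :
  (i <= n)%N -> (fps_inv_prefix f n)`_i = fps_inv f i.
Proof.
elim: n => [|n IHn]; first by rewrite leqn0 => /eqP ->.
rewrite leq_eqVlt ltnS => /predU1P [-> // | le_in].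
by rewrite /= nth_rcons size_fps_inv_prefix ltnS le_in IHn.
Qed.

Lemma fps_mulV (f : fps) : f 0%N != 0 -> fps_mul f (fps_inv f) =1 fps_one.
Proof.
move=> f0_neq0 [|n]; rewrite /fps_mul /fps_one.
  by rewrite big_ord_recl big_ord0 addr0 /fps_inv /= mulfV.
rewrite big_ord_recl subn0 {1}/fps_inv /= nth_rcons size_fps_inv_prefix.
rewrite ltnn eqxx mulNr mulrN mulVKf //.
apply/eqP; rewrite addrC subr_eq0; apply/eqP.
apply: eq_bigr => i _.
by rewrite /bump /= add1n subSS nth_fps_inv_prefix // leq_subr.
Qed.

Lemma fps_cos_sec : fps_mul fps_cos fps_sec =1 fps_one.
Proof. by apply: fps_mulV. Qed.

Lemma euler_egf (k : nat) :
  euler k / k`!%:R = fps_add fps_sec fps_tan k.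
Proof.
by rewrite /euler mulrAC mulfV ?mul1r // Num.Theory.pnatr_eq0 -lt0n fact_gt0.
Qed.

(* Main.v *)
Require Import Defs.
From mathcomp Require Import all_boot all_order all_algebra.
From mathcomp Require Import fingroup perm action ring.

Set Implicit Arguments.
Unset Strict Implicit.
Unset Printing Implicit Defensive.

Import GRing.Theory.
Local Open Scope ring_scope.

(** Put s := pi^3 o (pi^2)^-1, so that the levels of the columns are the numbers
    max(i, s i). A fixed s arises from prod_v m_v! weakly increasing pairs, m_v
    being the number of i of level v, whence WI_n is the sum of prod_v m_v! over S_n.
    Refine m! to a polynomial w_m with w_m(1) = m! and w_m' = m w_{m-1},
    and let Q_n be the sum of prod_v w_{m_v}. Inserting a new maximum into s either
    adds a fixed point (factor w_1 = X) or splits an arc, i.e. removes an arc of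
    some level and creates two arcs of the top level (factor w_2 = 1 + X^2). Hence
    Q_{n+1} = X Q_n + D Q_n for the derivation D = (1 + X^2) d/dX, and by induction
    Q_{n+1} = sum_k C(n, k) (D^k X) Q_{n-k}. Finally (D^k X)(1) = 2^k E_k because
    G = sec + tan is the solution of 2 G' = 1 + G^2 with G(0) = 1. *)

(** * Counting weakly increasing pairs by the multiplicities of their levels *)

(** Induction on [m]: a permutation preserving [L] and moving only levels up to [m] factors uniquely
    into one moving only levels below [m] and an arbitrary permutation of the fibre of [m]. *)
Lemma card_fiber_stable (T : finType) (L : T -> nat) (m : nat) :
  #|[set r : {perm T} | [forall i, L (r i) == L i] &&
       perm_on [set i | (L i < m)%N] r]| =
  (\prod_(v < m) (#|[set i | L i == v]|)`!)%N.
Proof.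
elim: m => [|m IHm].
  rewrite big_ord0; apply/eqP/cards1P; exists 1%g; apply/setP=> r.
  rewrite !inE; apply/idP/eqP => [/andP[_ r_on]|->].
    by apply/permP=> x; rewrite perm1 (out_perm r_on) // inE ltn0.
  by rewrite perm_on1 andbT; apply/forallP=> i; rewrite perm1.
rewrite big_ord_recr /= -IHm -card_perm -[X in (_ * X)%N]cardsE -cardsX.
set G := [set r : {perm T} | _] in IHm *; set F := [set i | L i == m].
have FP x : (x \in F) = (L x == m) by rewrite inE.
have GF (r : {perm T}) x : r \in G -> x \in F -> r x = x.
  rewrite !inE => /andP[_ r_on] /eqP Lx.
  by rewrite (out_perm r_on) // inE Lx ltnn.
rewrite -(@card_in_imset _ _ (fun u : {perm T} * {perm T} => (u.1 * u.2)%g)).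
  apply: eq_card => t; apply/idP/imsetP => [|[[r s]]].
    rewrite inE => /andP[/forallP Lt t_on].
    have tF : t \in ('N(F | 'P))%g.
      rewrite inE; apply/andP; split; rewrite ?inE //.
      by apply/subsetP=> x; rewrite !inE /aperm => /eqP <-; apply: Lt.
    have s_on := restr_perm_on F t.
    have Ls x : L (restr_perm F t x) = L x.
      have [xF|/(out_perm s_on) -> //] := boolP (x \in F).
      by rewrite restr_permE //; apply/eqP.
    (* [restr_perm F t] is the action of [t] on [F]; dividing by it leaves a permutation fixing [F]
       pointwise. *)
    exists ((t * (restr_perm F t)^-1)%g, restr_perm F t); last by rewrite /= mulgKV.
    apply/setXP; split; rewrite !inE //; apply/andP; split.
      apply/forallP=> x; rewrite permM -(eqP (Lt x)).
      by rewrite -{2}[t x](permKV (restr_perm F t)) Ls.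
    apply/subsetP=> x; rewrite !inE; apply: contraR; rewrite -leqNgt leq_eqVlt.
    case/orP=> [/eqP Lx|Lx].
      have xF : x \in F by rewrite FP Lx.
      by rewrite permM -(restr_permE tF xF) permK.
    rewrite permM (out_perm t_on) ?inE -?leqNgt // (canF_eq (permKV _)).
    by rewrite (out_perm s_on) // FP gtn_eqF.
  rewrite !inE /= => /andP[/andP[/forallP Lr r_on] s_on] ->.
  apply/andP; split.
    apply/forallP=> x; rewrite permM -(eqP (Lr x)).
    have [yF|/(out_perm s_on) -> //] := boolP (r x \in F).
    by have := perm_closed (r x) s_on; rewrite yF FP (eqP (_ : L (r x) == m)) -?FP.
  apply/subsetP=> x; rewrite !inE; apply: contraR; rewrite -leqNgt => Lx.
  rewrite permM (out_perm r_on) ?inE -?leqNgt ?(ltnW Lx) //.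
  by rewrite (out_perm s_on) // FP gtn_eqF.
move=> [r s] [r' s'] /setXP[/= Gr s_on] /setXP[/= Gr' s'_on] eq_rs.
rewrite !inE in s_on s'_on.
suff eq_s : s = s' by move: eq_rs; rewrite eq_s => /mulIg ->.
apply/permP=> x; have [xF|xF] := boolP (x \in F); last by rewrite !(out_perm _ xF).
have := congr1 (fun u : {perm T} => u x) eq_rs.
by rewrite !permM (GF r) // (GF r').
Qed.

(** All sorting permutations yield the same sorted sequence, so they form a single coset of the
    group of permutations preserving [L]. *)
Lemma card_sorting_perms (n m : nat) (L : 'I_n -> nat) :
  (forall i, (L i < m)%N) ->
  #|[set t : 'S_n | sorted leq [seq L (t j) | j <- enum 'I_n]]| =
  (\prod_(v < m) (#|[set i | L i == v]|)`!)%N.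
Proof.
move=> Lm; rewrite -card_fiber_stable.
have [t0 t0_sorted] : exists t0 : 'S_n, sorted leq [seq L (t0 j) | j <- enum 'I_n].
  pose s := sort (relpre L leq) (ord_tuple n).
  have /tuple_permP[p Ep] : perm_eq s (ord_tuple n) by rewrite perm_sort.
  exists p; rewrite (eq_map (g := L \o (tnth (ord_tuple n) \o p))); last first.
    by move=> j /=; rewrite tnth_ord_tuple.
  rewrite map_comp -[map (_ \o p) _]Ep sorted_map sort_sorted //.
  by move=> x y; apply: leq_total.
rewrite -[RHS](card_imset _ (mulgI t0)).
apply: eq_card => t; apply/idP/imsetP => [|[r]]; rewrite inE.
  move=> t_sorted; exists (t0^-1 * t)%g; last by rewrite mulKVg.
  have perm_map (u : 'S_n) : perm_eq [seq L (u j) | j <- enum 'I_n] [seq L j | j <- enum 'I_n].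
    rewrite map_comp perm_map // uniq_perm ?enum_uniq //.
      by rewrite map_inj_uniq ?enum_uniq //; apply: perm_inj.
    move=> x; rewrite mem_enum -[x](permKV u) map_f //.
    by rewrite mem_enum.
  have eq_t : [seq L (t j) | j <- enum 'I_n] = [seq L (t0 j) | j <- enum 'I_n].
    apply: (sorted_eq leq_trans anti_leq) => //.
    by rewrite (permPl (perm_map t)) perm_sym.
  rewrite inE; apply/andP; split; last first.
    by apply/subsetP=> x _; rewrite inE.
  apply/forallP=> i; rewrite permM -{2}[i](permKV t0).
  by have /eq_in_map-> := eq_t; rewrite // mem_enum.
rewrite inE => /andP[/forallP Lr _] ->; rewrite (eq_map (g := fun j => L (t0 j))) // => j.
by rewrite permM; apply/eqP.
Qed.

Definition level_count (n : nat) (s : 'S_n) (v : nat) : nat :=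
  #|[set i : 'I_n | maxn i (s i) == v]|.

Lemma WI_level_count (n : nat) :
  WI n = (\sum_(s : 'S_n) \prod_(v < n) (level_count s v)`!)%N.
Proof.
rewrite /WI -sum1dep_card.
(* Put pi^2 = t and pi^3 = s o t: column [j] has level [maxn i (s i)] at [i = t j], so for fixed [s]
   the condition says that [t] sorts this function of [i]. *)
rewrite (reindex (fun u : 'S_n * 'S_n => (u.2, u.2 * u.1)%g)) /=; last first.
  exists (fun u : 'S_n * 'S_n => (u.1^-1 * u.2, u.1)%g) => -[u v] _ /=.
    by rewrite mulKg.
  by rewrite mulKVg.
rewrite -(pair_big_dep predT (fun s t => @weakly_increasing n (t, (t * s)%g)) (fun _ _ => 1%N)) /=.
apply: eq_bigr => s _; rewrite sum1dep_card.
rewrite -(@card_sorting_perms _ _ (fun i => maxn i (s i))); last first.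
  by move=> i; rewrite gtn_max !ltn_ord.
apply: eq_card => t; rewrite !inE /weakly_increasing; congr sorted.
by apply: eq_map => j; rewrite /lev /column /= permM.
Qed.

(** * Binomial convolution, the derivation and the weights *)

Section BinomialConvolution.

Variable R : comPzRingType.
Implicit Types a b : nat -> R.

(** The product of exponential generating functions, on coefficient sequences. *)
Definition bconv a b (n : nat) : R :=
  \sum_(i < n.+1) a i * b (n - i)%N *+ 'C(n, i).

(** Leibniz rule for exponential generating functions, whose derivative is the shift; it amounts to
    Pascal's rule. *)
Lemma bconvS a b (n : nat) :
  bconv a b n.+1 = bconv (a \o succn) b n + bconv a (b \o succn) n.
Proof.
rewrite /bconv big_ord_recl /= bin0 subn0.
under eq_bigr => i _ do rewrite /bump /= add1n subSS binS mulrnDr.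
rewrite big_split /= addrA addrC; congr (_ + _).
rewrite [X in _ + X]big_ord_recr /= bin_small // mulr0n addr0 [RHS]big_ord_recl subn0 bin0.
congr (_ + _); apply: eq_bigr => i _.
by rewrite lift0 /= subnSK.
Qed.

End BinomialConvolution.

(* The vector field of the Riccati equation y' = 1 + y^2, whose flow is the tangent. *)
Definition tderiv (p : {poly rat}) : {poly rat} := (1 + 'X^2) * p^`().

Lemma tderivM (p q : {poly rat}) : tderiv (p * q) = tderiv p * q + p * tderiv q.
Proof. by rewrite /tderiv derivM; ring. Qed.

Lemma tderiv_sum (I : Type) (r : seq I) (F : I -> {poly rat}) :
  tderiv (\sum_(i <- r) F i) = \sum_(i <- r) tderiv (F i).
Proof. by rewrite /tderiv raddf_sum mulr_sumr. Qed.

Lemma tderivMn (p : {poly rat}) (k : nat) : tderiv (p *+ k) = tderiv p *+ k.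
Proof. by rewrite /tderiv derivMn mulrnAr. Qed.

(* The Appell sequence with value m! at 1, so that removing an arc of a level
   acts on the weight of that level as differentiation. *)
Fixpoint wt (m : nat) : {poly rat} :=
  if m is k.+1 then wt k *+ k.+1 + ('X - 1) ^+ k.+1 else 1.

Lemma deriv_wt (m : nat) : (wt m)^`() = wt m.-1 *+ m.
Proof.
elim: m => [|m IHm] /=; first by rewrite derivC mulr0n.
rewrite derivD derivMn IHm deriv_exp /= derivB derivX derivC subr0 mul1r -mulrnDl.
by case: m {IHm} => [|m] //=; rewrite mulr0n add0r expr0.
Qed.

Lemma wt_at1 (m : nat) : (wt m).[1] = m`!%:R.
Proof.
elim: m => [|m IHm] /=; first by rewrite hornerC.
rewrite hornerD hornerMn IHm horner_exp hornerD hornerN hornerX hornerC subrr.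
by rewrite expr0n addr0 factS mulnC natrM mulr_natr.
Qed.

(** * The polynomials Q_n and the insertion of a new maximum *)

Definition level_poly (n : nat) : {poly rat} :=
  \sum_(s : 'S_n) \prod_(v < n) wt (level_count s v).

Lemma level_poly_at1 (n : nat) : (level_poly n).[1] = (WI n)%:R.
Proof.
rewrite WI_level_count horner_sum natr_sum; apply: eq_bigr => s _.
by rewrite horner_prod natr_prod; apply: eq_bigr => v _; apply: wt_at1.
Qed.

Lemma level_countE (n : nat) (s : 'S_n) (v : nat) :
  level_count s v = (\sum_(i < n) (maxn i (s i) == v))%N.
Proof. by rewrite /level_count -sum1dep_card big_mkcond. Qed.

Lemma deriv_prod (A : comNzRingType) (I : eqType) (r : seq I) (F : I -> {poly A}) :
  uniq r ->
  (\prod_(i <- r) F i)^`() =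
  \sum_(i <- r) (F i)^`() * \prod_(j <- r | j != i) F j.
Proof.
elim: r => [|x r IHr] /=; first by rewrite !big_nil derivC.
case/andP=> x_r r_uniq; rewrite !big_cons derivM IHr // eqxx.
congr (_ * _ + _).
  rewrite [RHS]big_seq_cond [LHS]big_seq; apply: eq_bigl => j.
  by case: (j \in r) / boolP => //= j_r; rewrite (memPn x_r).
rewrite mulr_sumr; apply: eq_big_seq => i i_r.
by rewrite big_cons eq_sym (memPn x_r) // mulrCA.
Qed.

(** A level of multiplicity m contributes m equal terms with weight [wt m.-1], one for the removal
    of each index of that level. *)
Lemma deriv_level_prod (n : nat) (s : 'S_n) :
  (\prod_(v < n) wt (level_count s v))^`() =
  \sum_(i < n) \prod_(v < n) wt (level_count s v - (maxn i (s i) == v)).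
Proof.
rewrite deriv_prod ?index_enum_uniq //.
have Ln (i : 'I_n) : (maxn i (s i) < n)%N by rewrite gtn_max !ltn_ord.
rewrite [RHS](partition_big (fun i => Ordinal (Ln i)) predT) //=.
apply: eq_bigr => v _.
transitivity (\sum_(i < n | maxn i (s i) == v)
    wt (level_count s v).-1 * \prod_(j < n | j != v) wt (level_count s j)).
  rewrite deriv_wt mulrnAl sumr_const; congr (_ *+ _).
  by apply: eq_card => i; rewrite !inE.
apply: eq_bigr => i /eqP iv; rewrite [RHS](bigD1 v) //= iv eqxx subn1.
congr (_ * _); apply: eq_bigr => j.
by rewrite -val_eqE eq_sym => /negbTE /= ->; rewrite subn0.
Qed.

(** The arc [i -> s i] is split into [i -> n -> s i]; for [i = ord_max] the value [n] becomes a
    fixed point. *)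
Definition insert_max (n : nat) (i : 'I_n.+1) (s : 'S_n) : 'S_n.+1 :=
  (tperm ord_max i * lift_perm ord_max ord_max s)%g.

(** The preimage of the maximum gives back [i], cancelling the transposition gives back [s], and the
    cardinalities agree. *)
Lemma insert_max_bij (n : nat) :
  bijective (fun u : 'I_n.+1 * 'S_n => insert_max u.1 u.2).
Proof.
apply: inj_card_bij; last by rewrite card_prod card_ord !card_Sn.
move=> [i s] [j t] /= eq_ij.
have eq_i : i = j.
  have max_at (k : 'I_n.+1) (u : 'S_n) : insert_max k u k = ord_max.
    by rewrite permM tpermR lift_perm_id.
  by apply: (@perm_inj _ (insert_max i s)); rewrite {2}eq_ij !max_at.
move: eq_ij; rewrite /insert_max /= eq_i => /mulgI eq_st; congr (_, _).
apply/permP=> x; apply: (@lift_inj _ ord_max).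
by rewrite -!(lift_perm_lift ord_max) eq_st.
Qed.

Lemma level_count_insert_fixed (n : nat) (s : 'S_n) (v : nat) :
  level_count (insert_max ord_max s) v = (level_count s v + (n == v))%N.
Proof.
rewrite !level_countE (bigD1_ord ord_max) // addnC /insert_max tperm1 mul1g.
rewrite lift_perm_id maxnn; congr addn; apply: eq_bigr => i _.
by rewrite lift_perm_lift !lift_max.
Qed.

Lemma level_count_insert_arc (n : nat) (s : 'S_n) (i : 'I_n) (v : nat) :
  level_count (insert_max (lift ord_max i) s) v =
  (level_count s v - (maxn i (s i) == v) + (n == v).*2)%N.
Proof.
have sumE (F : 'I_n.+1 -> nat) : (\sum_i F i = F ord_max +
    (F (lift ord_max i) + \sum_(j < n | j != i) F (lift ord_max j)))%N.
  by rewrite (bigD1_ord ord_max) // (bigD1 i).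
(* Isolating index [i] in the count for [s] makes the truncated subtraction exact. *)
rewrite !level_countE sumE [in RHS](bigD1 i) // addKn /insert_max.
rewrite !permM tpermL tpermR lift_perm_lift lift_perm_id !lift_max.
rewrite (maxn_idPl (ltnW _)) // (maxn_idPr (ltnW _)) // addnA addnn addnC.
congr addn; apply: eq_bigr => j ji; rewrite permM tpermD ?neq_lift //.
  by rewrite lift_perm_lift !lift_max.
by rewrite (inj_eq lift_inj) eq_sym.
Qed.

Lemma level_poly0 : level_poly 0 = 1.
Proof.
rewrite /level_poly (bigD1 1%g) //= big_ord0 big1 ?addr0 // => s /eqP[].
by apply/permP=> -[].
Qed.

Lemma level_polyS (n : nat) :
  level_poly n.+1 = 'X * level_poly n + tderiv (level_poly n).
Proof.
rewrite /level_poly (reindex _ (onW_bij _ (insert_max_bij n))) /=.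
rewrite -(pair_big predT predT (fun i s => \prod_(v < n.+1) wt (level_count (insert_max i s) v))) /=.
rewrite (bigD1_ord ord_max) //; congr (_ + _).
  rewrite mulr_sumr; apply: eq_bigr => s _.
  rewrite (bigD1_ord ord_max) // level_count_insert_fixed eqxx.
  have -> : level_count s n = 0%N.
    rewrite level_countE big1 // => i _.
    by rewrite ltn_eqF // gtn_max !ltn_ord.
  (* The new level has one arc: [wt 1] is X. *)
  congr (_ * _); first by rewrite /= mulr1n expr1 addrC subrK.
  apply: eq_bigr => v _; rewrite level_count_insert_fixed lift_max.
  by rewrite gtn_eqF ?addn0.
rewrite exchange_big tderiv_sum; apply: eq_bigr => s _.
rewrite /tderiv deriv_level_prod mulr_sumr; apply: eq_bigr => i _.
rewrite (bigD1_ord ord_max) // level_count_insert_arc eqxx.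
have -> : level_count s n = 0%N.
  rewrite level_countE big1 // => j _.
  by rewrite ltn_eqF // gtn_max !ltn_ord.
(* The new level has two arcs: [wt 2] is 2X + (X - 1)^2 = 1 + X^2. *)
congr (_ * _); first by rewrite sub0n add0n /= double0; ring.
apply: eq_bigr => v _; rewrite level_count_insert_arc lift_max.
by rewrite (gtn_eqF (ltn_ord v)) addn0.
Qed.

(** * Iterates of the derivation and the convolution recurrence *)

(** The derivative polynomials of the tangent: the k-th derivative of tan is [tseq k] evaluated at
    tan. *)
Definition tseq (k : nat) : {poly rat} := iter k tderiv 'X.

Lemma tderiv_bconv (a b : nat -> {poly rat}) (n : nat) :
  tderiv (bconv a b n) = bconv (tderiv \o a) b n + bconv a (tderiv \o b) n.
Proof.
rewrite /bconv tderiv_sum -big_split; apply: eq_bigr => i _.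
by rewrite tderivMn tderivM mulrnDl.
Qed.

(** This is D^n applied to D X = 1 + X^2; the constant 1 survives only for [n = 0]. *)
Lemma tseqS (n : nat) : tseq n.+1 = (n == 0%N)%:R + bconv tseq tseq n.
Proof.
elim: n => [|n IHn].
  by rewrite /bconv big_ord1 /tseq /= /tderiv derivX mulr1.
rewrite {1}/tseq iterS -/(tseq n.+1) IHn bconvS add0r.
rewrite -[X in _ = X]tderiv_bconv.
rewrite [in LHS]/tderiv derivD mulrDr.
by case: n {IHn} => [|n]; rewrite ?derivC ?mulr0 ?add0r.
Qed.

(** X + D sends each term [tseq i * Q j] to [tseq i.+1 * Q j + tseq i * Q j.+1], the two shifts that
    appear in [bconvS]. *)
Lemma bconv_recurrence (Q : nat -> {poly rat}) (n : nat) :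
  Q 0%N = 1 -> (forall m, Q m.+1 = 'X * Q m + tderiv (Q m)) ->
  Q n.+1 = bconv tseq Q n.
Proof.
move=> Q0 QS; elim: n => [|n IHn].
  by rewrite QS /bconv big_ord1 Q0 /tderiv derivC mulr0 addr0 mulrC.
rewrite QS bconvS {}IHn tderiv_bconv addrCA; congr (_ + _).
rewrite /bconv mulr_sumr -big_split; apply: eq_bigr => i _ /=.
by rewrite QS mulrDr mulrnDl mulrnAr mulrCA.
Qed.

(** * Identification of the values at 1 with the Euler numbers *)

(** The Taylor coefficients of G(x) = tan(pi/4 + x/2), which equals sec x + tan x. *)
Definition egf (k : nat) : rat := (tseq k).[1] / (2 ^+ k * k`!%:R).

Lemma fact_neq0 (k : nat) : k`!%:R != 0 :> rat.
Proof. by rewrite Num.Theory.pnatr_eq0 -lt0n fact_gt0. Qed.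

(** The Riccati equation 2 G' = 1 + G^2 by coefficients, obtained from [tseqS] at X = 1. *)
Lemma egfS (k : nat) :
  2 * k.+1%:R * egf k.+1 = fps_one k + fps_mul egf egf k.
Proof.
rewrite /egf tseqS hornerD factS natrM exprS /fps_one.
have kS : k.+1%:R != 0 :> rat by rewrite Num.Theory.pnatr_eq0.
have k2 : 2 ^+ k != 0 :> rat by rewrite expf_neq0.
have kf := fact_neq0 k.
have -> (z : rat) : 2 * k.+1%:R * (z / (2 * 2 ^+ k * (k.+1%:R * k`!%:R))) = z / (2 ^+ k * k`!%:R).
  by field; rewrite nat1r kS kf k2.
rewrite mulrDl; congr (_ + _).
  by case: k {kS k2 kf} => [|k]; rewrite ?hornerC ?mul0r // divr1.
rewrite /bconv /fps_mul horner_sum mulr_suml; apply: eq_bigr => i _.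
have ik : (i <= k)%N by rewrite -ltnS.
rewrite hornerMn hornerM -mulr_natr.
have /(congr1 (fun m => m%:R : rat)) := bin_fact ik; rewrite !natrM => binE.
have -> : 2 ^+ k = 2 ^+ i * 2 ^+ (k - i) :> rat by rewrite -exprD subnKC.
have i2 : 2 ^+ i != 0 :> rat by rewrite expf_neq0.
have j2 : 2 ^+ (k - i) != 0 :> rat by rewrite expf_neq0.
rewrite -binE; field.
have := kf; rewrite -binE !mulf_eq0 !negb_or => /and3P[-> -> ->].
by rewrite i2 j2.
Qed.

(** Congruence to 0 modulo X^N: truncated series become polynomials, to which ring identities
    apply. *)
Definition low0 (N : nat) (p : {poly rat}) := forall i, (i < N)%N -> p`_i = 0.

Lemma low0D N p q : low0 N p -> low0 N q -> low0 N (p + q).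
Proof. by move=> hp hq i iN; rewrite coefD hp // hq // addr0. Qed.

Lemma low0M N p q : low0 N q -> low0 N (p * q).
Proof.
move=> hq i iN; rewrite coefM big1 // => j _; rewrite hq ?mulr0 //.
exact: leq_ltn_trans (leq_subr _ _) iN.
Qed.

Lemma coef_trunc_mul (N : nat) (f g : fps) (k : nat) : (k <= N)%N ->
  (\poly_(i < N.+1) f i * \poly_(i < N.+1) g i : {poly rat})`_k = fps_mul f g k.
Proof.
move=> kN; rewrite coefM; apply: eq_bigr => i _; rewrite !coef_poly !ltnS.
by rewrite !(leq_trans _ kN) ?leq_subr // -ltnS.
Qed.

(** The companion relation sin G = G - cos, proved simultaneously, closes the linear system whose
    uniqueness gives the claim. *)
Lemma cos_mul_egf (N : nat) : fps_mul fps_cos egf N = fps_one N + fps_sin N.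
Proof.
(* Truncation keeps products exact up to degree [N] but derivatives only below [N], hence the bounds
   [low0 N]. *)
pose C : {poly rat} := \poly_(i < N.+1) fps_cos i.
pose S : {poly rat} := \poly_(i < N.+1) fps_sin i.
pose G : {poly rat} := \poly_(i < N.+1) egf i.
have G0 : egf 0 = 1 by rewrite /egf /tseq /= hornerX.
have eC : low0 N (C^`() + S).
  move=> i iN; rewrite coefD coef_deriv !coef_poly !ltnS iN (ltnW iN).
  rewrite /fps_cos /fps_sin /= factS natrM.
  have i0 : i.+1%:R != 0 :> rat by rewrite Num.Theory.pnatr_eq0.
  have := fact_neq0 i.
  case: (boolP (odd i)) => oi fi; rewrite /= ?mul0rn ?addr0 //.
  by rewrite uphalf_half oi add1n exprS; field; rewrite nat1r i0 fi.
have eS : low0 N (S^`() - C).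
  move=> i iN; rewrite coefB coef_deriv !coef_poly !ltnS iN (ltnW iN).
  rewrite /fps_cos /fps_sin /= factS natrM.
  have i0 : i.+1%:R != 0 :> rat by rewrite Num.Theory.pnatr_eq0.
  have := fact_neq0 i.
  case: (boolP (odd i)) => oi fi; rewrite /= ?mul0rn ?subr0 //.
  by rewrite uphalf_half (negbTE oi) add0n; field; rewrite nat1r i0 fi.
have eG : low0 N (2 * G^`() - 1 - G * G).
  move=> i iN; rewrite !coefB coef_trunc_mul 1?ltnW // -polyC_natr coefCM.
  rewrite coef_deriv coef_poly ltnS iN coef1.
  have := egfS i; rewrite /fps_one => h.
  by rewrite -[egf i.+1 *+ _]mulr_natr [egf _ * _]mulrC mulrA h; ring.
(* Up to order N, 2 H' = G H - K and 2 K' = G K + H, so H = K = 0 by uniqueness. *)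
pose H := C * G - 1 - S; pose K := S * G + C - G.
have eH : low0 N (2 * H^`() - (G * H - K)).
  have -> : 2 * H^`() - (G * H - K) =
     C * (2 * G^`() - 1 - G * G) + ((2 * G) * (C^`() + S) + (-2) * (S^`() - C)).
    by rewrite /H /K !derivB derivM derivC; ring.
  by do !apply: low0D; apply: low0M.
have eK : low0 N (2 * K^`() - (G * K + H)).
  have -> : 2 * K^`() - (G * K + H) =
     (S - 1) * (2 * G^`() - 1 - G * G) + ((2 * G) * (S^`() - C) + 2 * (C^`() + S)).
    by rewrite /H /K !(derivB, derivD) derivM; ring.
  by do !apply: low0D; apply: low0M.
(* Coefficient [i] of each right-hand side involves only coefficients of [H] and [K] up to [i], so
   the system forces those of index [i.+1] to vanish. *)
have HK0 i : (i <= N)%N -> forall j, (j <= i)%N -> H`_j = 0 /\ K`_j = 0.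
  elim: i => [|i IHi] iN j.
    rewrite leqn0 => /eqP ->; rewrite !(coefB, coefD) !coef_trunc_mul // !coef_poly /=.
    rewrite coef1 /fps_mul !big_ord1 G0 /fps_cos /fps_sin /=.
    by split.
  rewrite leq_eqVlt => /predU1P[->|]; last exact: IHi (ltnW iN) j.
  have IH := IHi (ltnW iN).
  have GM0 (p : {poly rat}) : (forall j, (j <= i)%N -> p`_j = 0) -> (G * p)`_i = 0.
    by move=> p0; rewrite coefM big1 // => k _; rewrite p0 ?mulr0 // leq_subr.
  have solve (p : {poly rat}) : (2 * p^`())`_i = 0 -> p`_i.+1 = 0.
    rewrite -polyC_natr coefCM coef_deriv => /eqP.
    by rewrite mulf_eq0 !Num.Theory.mulrn_eq0 /= => /eqP.
  split; apply: solve.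
    have := eH i iN; rewrite coefB (coefB (G * H)) GM0 => [|k /IH[] //].
    by have [_ ->] := IH i (leqnn i); rewrite !subr0.
  have := eK i iN; rewrite coefB (coefD (G * K)) GM0 => [|k /IH[] //].
  by have [-> _] := IH i (leqnn i); rewrite !addr0.
have [/eqP + _] := HK0 N (leqnn N) N (leqnn N).
rewrite !coefB coef_trunc_mul // coef_poly ltnSn coef1 -addrA -opprD subr_eq0.
by move/eqP.
Qed.

(** Multiply cos G = 1 + sin by sec, the inverse of cos, modulo X^(N+1). *)
Lemma egf_sec_tan (N : nat) : egf N = fps_add fps_sec fps_tan N.
Proof.
pose tr (f : fps) : {poly rat} := \poly_(i < N.+1) f i.
have trE f i : (i < N.+1)%N -> (tr f)`_i = f i by rewrite coef_poly => ->.
have trM f g i : (i < N.+1)%N -> (tr f * tr g)`_i = fps_mul f g i.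
  by move=> iN; apply: coef_trunc_mul.
suff /(_ N (ltnSn N))/eqP : low0 N.+1 (tr egf - (tr fps_sec + tr fps_tan)).
  by rewrite coefB coefD !trE // subr_eq0 => /eqP.
have -> : tr egf - (tr fps_sec + tr fps_tan) =
    (- tr egf) * (tr fps_cos * tr fps_sec - 1) +
    (tr fps_sec * (tr fps_cos * tr egf - 1 - tr fps_sin) +
     1 * (tr fps_sin * tr fps_sec - tr fps_tan)) by ring.
do !apply: low0D; apply: low0M => i iN; rewrite !coefB ?trM ?trE ?coef1 //.
- by rewrite fps_cos_sec /fps_one subrr.
- by rewrite cos_mul_egf /fps_one; ring.
by rewrite subrr.
Qed.

Lemma tseq_euler (k : nat) : (tseq k).[1] = 2 ^+ k * euler k.
Proof.
rewrite /euler -egf_sec_tan /egf mulrA mulrC divfK //.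
by rewrite mulf_neq0 ?fact_neq0 ?expf_neq0.
Qed.

Unset Implicit Arguments.

Theorem theorem3p11 (n : nat) (hn : (1 <= n)%N) :
  (WI n)%:R =
    \sum_(0 <= k < n)
      'C(n - 1, k)%:R * 2 ^+ k * euler k * (WI (n - k - 1))%:R :> rat.
Proof.
(* The formula is the convolution recurrence for [level_poly] evaluated at X = 1. *)
case: n hn => // n _; rewrite -level_poly_at1.
rewrite (@bconv_recurrence level_poly n level_poly0 level_polyS) big_mkord.
rewrite /bconv horner_sum; apply: eq_bigr => k _.
rewrite hornerMn hornerM tseq_euler level_poly_at1 subn1 -mulr_natl !mulrA.
by rewrite subnAC subn1.
Qed.
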